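(* Let $X=(X_1,X_2)$ be an S$\alpha$S random vector with $\alpha\in(0,2]$ and spectral measure $\Gamma_X$. The symmetric covariation of $X_1$ and $X_2$ can be equivalently defined as follows: for $\beta\ge0$ and $m=0$ or $1$, $$[X_1,X_2]_{\alpha,\beta,m}=\frac{\Gamma(\alpha-\beta+1)}{\Gamma(\alpha+1)}\left(\lim_{(\theta_1,\theta_2)\to(0,1)}\int_{\{(s_1,s_2)\in S_2:\,|s_1|\le|s_2|\}}{}_{-\theta_2s_2/s_1}^{\;m}\mathrm D_{\theta_1}^{\beta}|\theta_1s_1+\theta_2s_2|^{\alpha}\,\Gamma_X(ds)+\lim_{(\theta_1,\theta_2)\to(1,0)}\int_{\{(s_1,s_2)\in S_2:\,|s_1|>|s_2|\}}{}_{-\theta_1s_1/s_2}^{\;m}\mathrm D_{\theta_2}^{\beta}|\theta_1s_1+\theta_2s_2|^{\alpha}\,\Gamma_X(ds)\right),$$ where in the first integral the fractional derivative is taken of $\theta_1\mapsto|\theta_1s_1+\theta_2s_2|^\alpha$ with base point $-\theta_2s_2/s_1$, and in the second of $\theta_2\mapsto|\theta_1s_1+\theta_2s_2|^\alpha$ with base point $-\theta_1s_1/s_2$.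
   Context: S$\alpha$S vectors: a real random vector $X=(X_1,X_2)$ is (jointly) S$\alpha$S with $\alpha\in(0,2]$ and spectral measure $\Gamma_X$ if $\Gamma_X$ is a symmetric finite nonnegative measure on the unit circle $S_2=\{s\in\mathbb R^2:\|s\|=1\}$ with $\mathbb E e^{i\langle\theta,X\rangle}=\exp\left(-\int_{S_2}|\langle\theta,s\rangle|^\alpha\,\Gamma_X(ds)\right)$ for all $\theta\in\mathbb R^2$. Symmetric covariation: for $\beta\ge0$, $m\in\{0,1\}$, $[X_1,X_2]_{\alpha,\beta,m}=\int_{S_2}K_{\alpha,\beta,m}(s_1,s_2)\,\Gamma_X(ds)$, where $$K_{\alpha,\beta,m}(s_1,s_2)=|s_1|^{\beta}|s_2|^{\alpha-\beta}\,\mathrm{sign}^m(s_1s_2)\mathbf 1_{\{|s_1|\le|s_2|\}}+|s_1|^{\alpha-\beta}|s_2|^{\beta}\,\mathrm{sign}^m(s_1s_2)\mathbf 1_{\{|s_1|>|s_2|\}},$$ $\mathrm{sign}(a)=1,0,-1$ for $a>0$, $a=0$, $a<0$, and $0^0=1$. Generalized fractional derivative: for a continuous function $f$ on $\mathbb R$, $x,a\in\mathbb R$, order $\beta\ge0$, $m\in\{0,1\}$ and $n=\lfloor\beta\rfloor+1$, $${}_a^{m}\mathrm D_x^{\beta}f(x)=\frac{1}{\Gamma(n-\beta)}\frac{d^n}{dx^n}\int_a^x f(t)(x-t)^n|x-t|^{-\beta-1}\,\mathrm{sign}^{m+1}(x-t)\,dt.$$ Here $a$ is called the base point. $\Gamma(\cdot)$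 without subscript is the gamma function.
   Formalization: The values β=α+1, α+2, …, where Γ(α−β+1) is undefined, are excluded; where s_1=0 (so that the base point −θ_2s_2/s_1 is undefined) the derivative is read as the limit over finite base points tending to ±∞. *)

(* Defs.v *)
From HB Require Import structures.
From mathcomp Require Import all_boot all_order all_algebra.
From mathcomp Require Import complex.
From mathcomp Require Import all_classical all_reals all_analysis.

Set Implicit Arguments.
Unset Strict Implicit.
Unset Printing Implicit Defensive.
Import Order.TTheory GRing.Theory Num.Theory.
Import numFieldNormedType.Exports.

Local Open Scope classical_set_scope.
Local Open Scope ring_scope.

Section GammaFunction.
Variable R : realType.
Implicit Type x : R.

Definition Euler_integral x : R :=
  \int[lebesgue_measure]_(t in `]0, +oo[) (t `^ (x - 1) * expR (- t)).

(* For x <= 0 the Euler integral is continued by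
   Gamma x = Gamma (x + N) / (x (x + 1) ... (x + N - 1)), with x + N > 0.
   At the poles 0, -1, -2, ... the value is the meaningless 0. *)
Definition Gamma x : R :=
  if 0 < x then Euler_integral x
  else let N := (Num.truncn (- x)).+1 in
    Euler_integral (x + N%:R) / \prod_(k < N) (x + k%:R).

End GammaFunction.

Section FractionalDerivative.
Variable R : realType.
Implicit Types (f : R -> R) (a x beta : R) (m : nat).

Definition oriented_integral a x f : R :=
  if a <= x then \int[lebesgue_measure]_(t in `[a, x]) f t
  else - \int[lebesgue_measure]_(t in `[x, a]) f t.

Definition frac_derive m beta a f x : R :=
  let n := (Num.truncn beta).+1 in
  (Gamma (n%:R - beta))^-1 *
  derive1n n (fun y => oriented_integral a y (fun t =>
    f t * (y - t) ^+ n * `|y - t| `^ (- beta - 1) *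
    Num.sg (y - t) ^+ m.+1)) x.

(* A base point -theta_2 s_2 / s_1 with s_1 = 0 is infinite; the derivative
   with an infinite base point is the limit over finite base points. *)
Definition efrac_derive m beta (a : \bar R) f x : R :=
  match a with
  | b%:E => frac_derive m beta b f x
  | +oo%E => lim (frac_derive m beta b f x @[b --> +oo])
  | -oo%E => lim (frac_derive m beta b f x @[b --> -oo])
  end.

End FractionalDerivative.

Section SymmetricStable.
Variable R : realType.
Implicit Types (s theta : R * R) (alpha beta : R) (m : nat).
Implicit Type Gam : {finite_measure set (R * R)%type -> \bar R}.

(* The library norm on R * R is the max norm, hence the explicit equation. *)
Definition unit_circle : set (R * R)%type := [set s | s.1 ^+ 2 + s.2 ^+ 2 = 1].

Definition dotp theta s : R := theta.1 * s.1 + theta.2 * s.2.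

(* Measures on the circle are measures on the plane carried by the circle. *)
Definition symmetric_on_circle Gam : Prop :=
  Gam (~` unit_circle) = 0%E /\
  forall A : set (R * R)%type, measurable A -> Gam (-%R @` A) = Gam A.

Definition char_fun d (T : measurableType d) (P : probability T R)
    (X : {RV P >-> (R * R)%type}) theta : R[i] :=
  (fine 'E_P[fun w => cos (dotp theta (X w))] +i*
   fine 'E_P[fun w => sin (dotp theta (X w))])%C.

Definition is_SaS d (T : measurableType d) (P : probability T R)
    (X : {RV P >-> (R * R)%type}) alpha Gam : Prop :=
  symmetric_on_circle Gam /\
  forall theta, char_fun X theta =
    (expR (- \int[Gam]_(s in unit_circle) (`|dotp theta s| `^ alpha)))%:C%C.

Definition sc_kernel alpha beta m s : R :=
  if `|s.1| <= `|s.2|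
  then `|s.1| `^ beta * `|s.2| `^ (alpha - beta) * Num.sg (s.1 * s.2) ^+ m
  else `|s.1| `^ (alpha - beta) * `|s.2| `^ beta * Num.sg (s.1 * s.2) ^+ m.

Definition symmetric_covariation Gam alpha beta m : R :=
  \int[Gam]_(s in unit_circle) sc_kernel alpha beta m s.

Definition circle_le : set (R * R)%type :=
  unit_circle `&` [set s | `|s.1| <= `|s.2|].

Definition circle_gt : set (R * R)%type :=
  unit_circle `&` [set s | `|s.1| > `|s.2|].

(* In \bar R, 0^-1 = +oo, so the base point is infinite when s.1 = 0. *)
Definition frac_theta1 alpha beta m theta s : R :=
  efrac_derive m beta (- (theta.2 * s.2)%:E / s.1%:E)%E
    (fun t => `|dotp (t, theta.2) s| `^ alpha) theta.1.

Definition frac_theta2 alpha beta m theta s : R :=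
  efrac_derive m beta (- (theta.1 * s.1)%:E / s.2%:E)%E
    (fun t => `|dotp (theta.1, t) s| `^ alpha) theta.2.

End SymmetricStable.

Arguments unit_circle {R}.
Arguments circle_le {R}.
Arguments circle_gt {R}.

(* Main.v *)
Require Import Defs.
From HB Require Import structures.
From mathcomp Require Import all_boot all_order all_algebra.
From mathcomp Require Import complex.
From mathcomp Require Import all_classical all_reals all_analysis.
From mathcomp Require Import measurable_realfun.
From mathcomp Require Import ring lra.
Import Order.TTheory GRing.Theory Num.Theory.
Import numFieldNormedType.Exports.

(** For [s] on the circle with [s.1 != 0], the function
    [t |-> `|t * s.1 + theta.2 * s.2| `^ alpha] equals
    [`|s.1| `^ alpha * `|t - b| `^ alpha], where [b = - (theta.2 * s.2) / s.1] is
    precisely the base point of the derivative. The integral defining the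
    derivative is then a beta integral
    ([oriented_integral_pow], [gamma_int_beta_int]), a multiple of a signed power
    of [x - b]; differentiating it [n] times and cancelling gamma factors gives
    the expected formula ([frac_derive_pow]): the exponent drops from [alpha] to
    [alpha - beta], with coefficient
    [Gamma (alpha + 1) / Gamma (alpha - beta + 1)] and sign
    [Num.sg (x - b) ^+ m]. In terms of the linear form [w = dotp theta s] the
    derivative is this coefficient times
    [`|s.1| `^ beta * `|w| `^ (alpha - beta) * Num.sg (s.1 * w) ^+ m]
    ([frac_line_pow_finite]).

    When [s.1 = 0] the function is constant and the base point is infinite. The
    limit of the derivatives over finite base points agrees with the same formula
    except if [beta = 0] and [m = 1], where it has the sign of the linear form
    instead of being zero ([frac_line_powE]). These exceptional values sit at two
    antipodal points and are opposite to each other, so they cancel in the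
    integral because the spectral measure is symmetric
    ([Rintegral_sg_balanced]).

    As [theta] tends to [(0, 1)], the linear form divided by [s.2] tends to [1]
    uniformly on the part of the circle where [`|s.1| <= `|s.2|], and [`|s.2|]
    is at least [1 / 2] there. Hence the integrals converge to the coefficient times
    the integral of the covariation kernel over that part
    ([integral_frac_line_pow_near]). The other part is treated by exchanging the
    coordinates. The sum of the two limits is the coefficient times the symmetric
    covariation, and the prefactor of the theorem inverts the coefficient
    ([Gamma_frac_pow_coef]). *)

Set Implicit Arguments.
Unset Strict Implicit.
Unset Printing Implicit Defensive.

Local Open Scope classical_set_scope.
Local Open Scope ring_scope.

(** * Affine changes of variable in Lebesgue integrals *)

Section AffineSubstitution.
Context {R : realType}.
Local Notation mu := (@lebesgue_measure R).
Local Open Scope ereal_scope.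

(** Lebesgue measure equals [c] times its image under [t |-> c * t + d], since
    both agree on the intervals [`]a, b]] that generate the Borel sets. *)
Lemma ge0_integral_affine (f : R -> \bar R) (c d : R) :
  (0 < c)%R -> measurable_fun [set: R] f -> (forall t, 0 <= f t) ->
  \int[mu]_t f (c * t + d)%R = (c^-1)%:E * \int[mu]_t f t.
Proof.
move=> c0 mf f0.
pose phi : measurableTypeR R -> measurableTypeR R := fun t => (c * t + d)%R.
have mphi : measurable_fun [set: measurableTypeR R] phi.
  by apply: measurable_funD => //; exact: measurable_funM.
pose nu_ : {measure set (measurableTypeR R) -> \bar R} := pushforward mu phi.
pose nu := nu_ mphi.
have nuc A : measurable A -> mu A = mscale (NngNum (ltW c0)) nu A.
  move=> mA; apply: (lebesgue_measure_unique _ mA) => _ [[a b]] _ <-.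
  rewrite /mscale /nu /nu_ /pushforward /=.
  rewrite [X in _ = _ * X](_ : _ =
      mu `]((a - d) / c)%R, ((b - d) / c)%R]%classic); last first.
    congr (mu _); apply/seteqP; split=> t /=; rewrite !in_itv/= /phi;
      by rewrite ltr_pdivrMr// ler_pdivlMr// ltrBlDr lerBrDr mulrC.
  rewrite !lebesgue_measure_itv/= !lte_fin ltr_pM2r ?invr_gt0// ltrD2r.
  case: ifPn => ab; last by rewrite mule0.
  rewrite -!EFinD -EFinM; congr EFin; field; exact: lt0r_neq0.
have -> : \int[mu]_t f t = \int[mscale (NngNum (ltW c0)) nu]_t f t.
  by apply: eq_measure_integral => A mA _; exact: nuc mA.
rewrite ge0_integral_mscale//= muleA -EFinM mulVf ?gt_eqF// mul1e.
by rewrite (ge0_integral_pushforward mphi mu).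
Qed.

Lemma ge0_integral_reflect (f : R -> \bar R) :
  measurable_fun [set: R] f -> (forall t, 0 <= f t) ->
  \int[mu]_t f (- t)%R = \int[mu]_t f t.
Proof.
move=> mf f0.
pose phi : measurableTypeR R -> measurableTypeR R := -%R.
have mphi : measurable_fun [set: measurableTypeR R] phi by exact: oppr_measurable.
rewrite -[LHS](@ge0_integral_pushforward _ _ _ _ _ _ mphi mu setT f)//.
by apply: eq_measure_integral => A mA _; exact: lebesgue_measureN.
Qed.

End AffineSubstitution.

(** * Euler's integrals of the first and second kind *)

Section EulerIntegrals.
Context {R : realType}.
Local Notation mu := (@lebesgue_measure R).
Implicit Types a b p q t z : R.

Lemma ge0_integralZl_EFin_lebesgue (k : R) (g : R -> R) : 0 <= k ->
  measurable_fun [set: R] g -> (forall t, 0 <= g t) ->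
  (\int[mu]_t (k * g t)%:E = k%:E * \int[mu]_t (g t)%:E)%E.
Proof.
move=> k0 mg g0; under eq_integral do rewrite EFinM.
rewrite ge0_integralZl//; last by move=> t _; rewrite lee_fin.
by apply/measurable_EFinP.
Qed.

(** Powers cut off at [0] turn the two Euler integrals into integrals over the
    whole line, where translations and the exchange of integrals act without
    any bookkeeping of domains. *)
Definition truncpow p t : R := if 0 < t then t `^ p else 0.

Lemma truncpow_ge0 p t : 0 <= truncpow p t.
Proof. by rewrite /truncpow; case: ifP => // _; exact: powR_ge0. Qed.

Lemma gt0_truncpow p t : 0 < t -> truncpow p t = t `^ p.
Proof. by rewrite /truncpow => ->. Qed.

Lemma le0_truncpow p t : t <= 0 -> truncpow p t = 0.
Proof. by rewrite /truncpow leNgt => /negbTE ->. Qed.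

Lemma measurable_truncpow p : measurable_fun [set: R] (truncpow p).
Proof.
apply: measurable_fun_ifT => //; first exact: measurable_fun_ltr.
Qed.

Lemma truncpowM p c t : 0 < c -> truncpow p (c * t) = c `^ p * truncpow p t.
Proof.
move=> c0; rewrite /truncpow pmulr_rgt0//; case: ifP => t0; last by rewrite mulr0.
by rewrite powRM// ltW.
Qed.

(** The two integrals take values in [\bar R]: Tonelli's theorem then applies
    before anything is known to be finite, and finiteness is deduced from the
    identities that it gives. *)
Definition gamma_int a : \bar R :=
  \int[mu]_t (truncpow (a - 1) t * expR (- t))%:E.

Definition beta_int a b : \bar R :=
  \int[mu]_t (truncpow (a - 1) t * truncpow (b - 1) (1 - t))%:E.

Lemma measurable_truncpow_conv a b z :
  measurable_fun [set: R] (fun t => truncpow a t * truncpow b (z - t)).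
Proof.
apply: measurable_funM; first exact: measurable_truncpow.
apply: measurableT_comp; first exact: measurable_truncpow.
exact: measurable_funB.
Qed.

(** The substitution [t = z * u] extracts all powers of [z]; the factor [z] of
    the Lebesgue measure accounts for the [+ 1] in the exponent. *)
Lemma truncpow_conv a b z :
  (\int[mu]_t (truncpow (a - 1) t * truncpow (b - 1) (z - t))%:E =
   (truncpow (a + b - 1) z)%:E * beta_int a b)%E.
Proof.
have [z0|z0] := leP z 0.
  rewrite le0_truncpow// mul0e; apply: integral0_eq => t _.
  have [t0|t0] := leP t 0; first by rewrite le0_truncpow// mul0r.
  by rewrite [X in _ * X]le0_truncpow ?mulr0//; lra.
pose f t := (truncpow (a - 1) t * truncpow (b - 1) (z - t))%:E.
have mf : measurable_fun [set: R] f.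
  by apply/measurable_EFinP; exact: measurable_truncpow_conv.
have f0 t : (0 <= f t)%E by rewrite lee_fin mulr_ge0// truncpow_ge0.
have zK (u : \bar R) : (z%:E * ((z^-1)%:E * u) = u)%E.
  by rewrite muleA -EFinM mulfV ?gt_eqF// mul1e.
transitivity (z%:E * \int[mu]_t f (z * t + 0)%R)%E.
  by rewrite ge0_integral_affine// zK.
under eq_integral => t _.
  rewrite /f addr0 -{2}(mulr1 z) -mulrBr !truncpowM// mulrACA.
  over.
rewrite ge0_integralZl_EFin_lebesgue; last 3 first.
- by rewrite mulr_ge0// powR_ge0.
- exact: measurable_truncpow_conv.
- by move=> t; rewrite mulr_ge0// truncpow_ge0.
rewrite muleA -EFinM gt0_truncpow//; congr (_%:E * _)%E.
rewrite -{1}(powRr1 (ltW z0)) -!powRD ?(gt_eqF z0) ?implybT//.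
by congr powR; ring.
Qed.

(** The substitution [y = z - x] turns the product of the two gamma integrals,
    in [x] and [y], into an integral over [z] of [expR (- z)] times a convolution
    of truncated powers, to which [truncpow_conv] applies. *)
Lemma gamma_int_beta_int a b :
  (gamma_int a * gamma_int b = gamma_int (a + b) * beta_int a b)%E.
Proof.
pose f (xz : R * R) := (truncpow (a - 1) xz.1 *
  (truncpow (b - 1) (xz.2 - xz.1) * expR (- xz.2)))%:E.
have f0 xz : (0 <= f xz)%E by rewrite lee_fin !mulr_ge0 ?truncpow_ge0// expR_ge0.
have mf : measurable_fun [set: R * R] f.
  apply/measurable_EFinP; apply: measurable_funM.
    exact: measurableT_comp (measurable_truncpow _) _.
  apply: measurable_funM.
    apply: measurableT_comp (measurable_truncpow _) _.
    exact: measurable_funB.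
  by do 2 apply: measurableT_comp => //.
have := @fubini_tonelli _ _ _ _ _ mu mu f mf f0.
have mg c : measurable_fun [set: R] (fun t => truncpow (c - 1) t * expR (- t)).
  apply: measurable_funM; first exact: measurable_truncpow.
  by do 2 apply: measurableT_comp => //.
have g0 c t : 0 <= truncpow (c - 1) t * expR (- t).
  by rewrite mulr_ge0 ?truncpow_ge0 ?expR_ge0.
have beta0 : (0 <= beta_int a b)%E.
  by apply: integral_ge0 => t _; rewrite lee_fin mulr_ge0// truncpow_ge0.
have gam0 c : (0 <= gamma_int c)%E.
  by apply: integral_ge0 => t _; rewrite lee_fin.
set l := LHS; have -> : l = (gamma_int a * gamma_int b)%E.
  rewrite /l muleC [X in (_ = _ * X)%E]/gamma_int -ge0_integralZl//; last 2 first.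
  - by apply/measurable_EFinP; exact: mg.
  - by move=> t _; rewrite lee_fin.
  apply: eq_integral => x _; rewrite muleC.
  have <- : (\int[mu]_t (truncpow (b - 1) (1 * t - x) * expR (- (1 * t - x)))%:E =
      gamma_int b)%E.
    rewrite (@ge0_integral_affine _ (fun t => (truncpow (b - 1) t * expR (- t))%:E))//.
    - by rewrite invr1 mul1e.
    - by apply/measurable_EFinP; exact: mg.
    - by move=> t; rewrite lee_fin.
  transitivity (\int[mu]_t ((truncpow (a - 1) x * expR (- x)) *
      (truncpow (b - 1) (1 * t - x) * expR (- (1 * t - x))))%:E)%E; last first.
    rewrite ge0_integralZl_EFin_lebesgue//.
    apply: (measurableT_comp (mg b)) => //.
    exact: measurable_funB.
  apply: eq_integral => z _; rewrite /f/= mul1r; congr EFin.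
  rewrite mulrACA -expRD [LHS]mulrA; congr (_ * expR _); lra.
move=> ->.
rewrite [RHS]muleC -ge0_integralZl//; last 2 first.
- by apply/measurable_EFinP; exact: mg.
- by move=> t _; rewrite lee_fin.
apply: eq_integral => z _.
rewrite EFinM muleA [X in (X * _)%E]muleC -truncpow_conv muleC.
rewrite -ge0_integralZl_EFin_lebesgue ?expR_ge0//; last 2 first.
- exact: measurable_truncpow_conv.
- by move=> t; rewrite mulr_ge0// truncpow_ge0.
by apply: eq_integral => x _; rewrite /f/=; congr EFin; ring.
Qed.

End EulerIntegrals.

(** * The gamma function *)

Section GammaRecurrence.
Context {R : realType}.
Local Notation mu := (@lebesgue_measure R).
Implicit Types a b p q t x z : R.

Lemma integral_powR_itv a e : 0 < a -> 0 < e -> e < 1 ->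
  (\int[mu]_(t in `[e, 1%R]) (t `^ (a - 1))%:E = (a^-1 * (1 - e `^ a))%:E)%E.
Proof.
move=> a0 e0 e1.
have dF t : 0 < t -> is_derive t 1 (fun u : R => a^-1 * u `^ a) (t `^ (a - 1)).
  move=> t0; rewrite -[t `^ _](mulKf (lt0r_neq0 a0)).
  exact (is_deriveZ a^-1 (is_derive1_powR a t0)).
have cF t : 0 < t -> {for t, continuous (fun u : R => a^-1 * u `^ a)}.
  move=> t0; have [dFt _] := dF t t0.
  exact/differentiable_continuous/derivable1_diffP.
rewrite (@continuous_FTC2 _ _ (fun u => a^-1 * u `^ a))//.
- by rewrite -EFinB powR1 -mulrBr.
- apply: derivable_within_continuous => t; rewrite in_itv/= => /andP[et _].
  by apply: derivable_powR; rewrite in_itv/= andbT (lt_le_trans e0).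
- split.
  + by move=> t; rewrite in_itv/= => /andP[et _]; have [] := dF t (lt_trans e0 et).
  + exact/cvg_at_right_filter/cF.
  + exact/cvg_at_left_filter/cF.
- move=> t; rewrite in_itv/= => /andP[et _].
  by rewrite derive1E; have [_ ->] := dF t (lt_trans e0 et).
Qed.

(** The integrand is unbounded at [0] when [a < 1], so the fundamental theorem
    of calculus is used on [`[1 / n, 1]] and followed by monotone convergence. *)
Lemma beta_int_1 a : 0 < a -> beta_int a 1 = (a^-1)%:E.
Proof.
move=> a0.
have -> : beta_int a 1 = (\int[mu]_(t in `]0%R, 1%R]) (t `^ (a - 1))%:E)%E.
  rewrite -(@integral_itv_bndo_bndc _ (BRight 0) 1); last first.
    by apply/measurable_EFinP; apply: measurable_funTS; exact: measurable_powR.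
  rewrite [RHS]integral_mkcond; apply: eq_integral => t _.
  rewrite patchE mem_setE in_itv/= subrr /truncpow subr_gt0 powRr0.
  by case: (ltP 0 t) => t0; case: (ltP t 1) => t1 /=; rewrite ?mulr1 ?mulr0 ?mul0r.
(* Starting at [2^-1] keeps the first interval nondegenerate. *)
pose F (n : nat) : set R := `[n.+2%:R^-1, 1]%classic.
have FE : \bigcup_n F n = `]0, 1]%classic.
  apply/seteqP; split=> [t [n _]|t]; rewrite /F/= !in_itv/= => /andP[t0 t1].
    by rewrite t1 andbT (lt_le_trans _ t0).
  exists (Num.truncn t^-1) => //=; rewrite in_itv/= t1 andbT.
  rewrite invf_ple ?posrE//; apply/ltW/(lt_le_trans (truncnS_gt _)).
  by rewrite ler_nat.
have F_cvg : (\int[mu]_(t in F n) (t `^ (a - 1))%:E @[n --> \oo] -->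
    \int[mu]_(t in `]0%R, 1%R]) (t `^ (a - 1))%:E)%E.
  rewrite -FE; apply: ge0_nondecreasing_set_cvg_integral => //.
  - move=> n m nm; apply/subsetPset => t; rewrite /F/= !in_itv/= => /andP[nt ->].
    by rewrite andbT (le_trans _ nt)// lef_pV2 ?posrE// ler_nat.
  - by move=> n; exact: measurable_itv.
  - by move=> n; apply/measurable_EFinP; apply: measurable_funTS; exact: measurable_powR.
  - by move=> n t _; rewrite lee_fin powR_ge0.
have FnE n : (\int[mu]_(t in F n) (t `^ (a - 1))%:E =
    (a^-1 * (1 - n.+2%:R^-1 `^ a))%:E)%E.
  by rewrite integral_powR_itv// invf_lt1// ltr1n.
apply: (cvg_unique _ F_cvg) => //.
rewrite (_ : (fun n => _) = (EFin \o (fun n => a^-1 * (1 - n.+2%:R^-1 `^ a))));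
  last by apply/funext => n; rewrite FnE.
apply: cvg_EFin; first exact: nearW.
have inv_cvg : n.+2%:R^-1 `^ a @[n --> \oo] --> (0 : R).
  move/cvg_at_rightP: (powR_cvg0 a0); apply; split=> //.
  rewrite (_ : (fun n => _) = (fun n => (@harmonic R) (n + 1)%N)).
    rewrite (cvg_shiftn 1 (@harmonic R)); exact: cvg_harmonic.
  by apply/funext => n; rewrite /harmonic/= addn1.
have : a^-1 * (1 - n.+2%:R^-1 `^ a) @[n --> \oo] --> a^-1 * (1 - 0).
  by apply: cvgZr; apply: cvgB => //; exact: cvg_cst.
by rewrite subr0 mulr1.
Qed.

Lemma gamma_int_ge0 a : (0 <= gamma_int a)%E.
Proof.
by apply: integral_ge0 => t _; rewrite lee_fin mulr_ge0 ?truncpow_ge0 ?expR_ge0.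
Qed.

Lemma gamma_int_1 : gamma_int (1 : R) = 1%E.
Proof.
have mexp : measurable_fun [set: R] (fun t : R => expR (- t)).
  by do 2 apply: measurableT_comp => //.
rewrite -(integral_exponential_pdf (@ltr01 R)).
transitivity (\int[mu]_(t in `]0%R, +oo[) (expR (- t))%:E)%E.
  rewrite [RHS]integral_mkcond; apply: eq_integral => t _.
  rewrite patchE mem_setE in_itv/= andbT subrr /truncpow powRr0.
  by case: ifP => _; rewrite ?mul1r ?mul0r.
rewrite integral_itv_obnd_cbnd; last first.
  by apply/measurable_EFinP; apply: measurable_funTS.
rewrite [LHS]integral_mkcond; apply: eq_integral => t _.
rewrite /exponential_pdf !patchE; case: ifP => // _.
by rewrite mul1r mulN1r.
Qed.

Lemma gamma_int_beta_1 a : 0 < a -> (gamma_int a = gamma_int (a + 1) * (a^-1)%:E)%E.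
Proof. by move=> a0; rewrite -beta_int_1// -gamma_int_beta_int gamma_int_1 mule1. Qed.

(** The case [b = 1] of [gamma_int_beta_int], as [beta_int a 1] is [a^-1]. *)
Lemma gamma_intS a : 0 < a -> (gamma_int (a + 1) = a%:E * gamma_int a)%E.
Proof.
move=> a0; rewrite [in RHS](gamma_int_beta_1 a0) muleCA -EFinM mulfV ?gt_eqF//.
by rewrite mule1.
Qed.

Lemma gamma_int_lty_nat n : (gamma_int (n.+1%:R : R) < +oo)%E.
Proof.
elim: n => [|n IH]; first by rewrite gamma_int_1 ltry.
by rewrite -natr1 gamma_intS// lte_mul_pinfty.
Qed.

Lemma measurable_gamma_integrand a :
  measurable_fun [set: R] (fun t => truncpow (a - 1) t * expR (- t)).
Proof.
apply: measurable_funM; first exact: measurable_truncpow.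
by do 2 apply: measurableT_comp => //.
Qed.

(** The recurrence reduces to exponents at least [1], where [t `^ a] is at most
    [1 + t `^ n.+1] with [n] the integral part of [a]; at integers the recurrence
    started at [gamma_int 1 = 1] gives a finite value. *)
Lemma gamma_int_lty a : 0 < a -> (gamma_int a < +oo)%E.
Proof.
move=> a0; rewrite gamma_int_beta_1// lte_mul_pinfty ?gamma_int_ge0//.
  pose n := Num.truncn a; rewrite ge0_fin_numE ?gamma_int_ge0//.
  have le_int : (gamma_int (a + 1) <= gamma_int (1 : R) + gamma_int (n.+2%:R : R))%E.
    rewrite -ge0_integralD//; first last.
    - by apply/measurable_EFinP; exact: measurable_gamma_integrand.
    - by move=> t _; rewrite lee_fin mulr_ge0 ?truncpow_ge0 ?expR_ge0.
    - by apply/measurable_EFinP; exact: measurable_gamma_integrand.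
    - by move=> t _; rewrite lee_fin mulr_ge0 ?truncpow_ge0 ?expR_ge0.
    apply: ge0_le_integral => //.
    - by move=> t _; rewrite lee_fin mulr_ge0 ?truncpow_ge0 ?expR_ge0.
    - by apply/measurable_EFinP; exact: measurable_gamma_integrand.
    - by apply/measurable_EFinP; apply: measurable_funD; exact: measurable_gamma_integrand.
    move=> t _; rewrite lee_fin -mulrDl ler_wpM2r ?expR_ge0// subrr addrK.
    rewrite /truncpow; case: ifP => [t0|_]; last by rewrite addr0.
    rewrite powRr0; have [t1|t1] := leP t 1.
      rewrite -[X in X <= _]addr0 lerD ?powR_ge0//.
      by have -> : (1 : R) = 1 `^ a by [rewrite powR1]; rewrite ge0_ler_powR// ?nnegrE ltW.
    rewrite ler_wpDl// ler_powR ?(ltW t1)//.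
    rewrite -natr1 addrK; exact/ltW/truncnS_gt.
  apply: (le_lt_trans le_int); rewrite gamma_int_1 lte_add_pinfty ?ltry//.
  exact: gamma_int_lty_nat.
by rewrite ltry.
Qed.

(** On [`]0, 1[] the exponential is at least [expR (-1)], so the gamma integral
    dominates [expR (-1)] times [beta_int a 1], which is [a^-1]. *)
Lemma gamma_int_gt0 a : 0 < a -> (0 < gamma_int a)%E.
Proof.
move=> a0; apply: (@lt_le_trans _ _ (expR (-1) * a^-1)%:E).
  by rewrite lte_fin mulr_gt0 ?expR_gt0 ?invr_gt0.
rewrite EFinM -beta_int_1// -ge0_integralZl_EFin_lebesgue ?expR_ge0//; last 2 first.
- exact: measurable_truncpow_conv.
- by move=> t; rewrite mulr_ge0// truncpow_ge0.
apply: ge0_le_integral => //.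
- by move=> t _; rewrite lee_fin !mulr_ge0 ?truncpow_ge0 ?expR_ge0.
- apply/measurable_EFinP; apply: measurable_funM => //; exact: measurable_truncpow_conv.
- by apply/measurable_EFinP; exact: measurable_gamma_integrand.
move=> t _; rewrite lee_fin mulrC -mulrA ler_wpM2l ?truncpow_ge0//.
rewrite subrr /truncpow subr_gt0 powRr0; case: ifP => [t1|_].
  by rewrite mul1r ler_expR lerN2 ltW.
by rewrite mul0r expR_ge0.
Qed.

Lemma Euler_integralE a : Euler_integral a = fine (gamma_int a).
Proof.
rewrite /Euler_integral Rintegral_mkcond; congr fine; apply: eq_integral => t _.
rewrite patchE mem_setE in_itv/= andbT /truncpow.
by case: ifP => _; rewrite ?mul0r.
Qed.

Lemma gamma_intE a : 0 < a -> gamma_int a = (Euler_integral a)%:E.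
Proof.
by move=> a0; rewrite Euler_integralE fineK// ge0_fin_numE ?gamma_int_ge0 ?gamma_int_lty.
Qed.

Lemma Euler_integral_gt0 a : 0 < a -> 0 < Euler_integral a.
Proof. by move=> a0; rewrite -lte_fin -gamma_intE// gamma_int_gt0. Qed.

Lemma Euler_integralS a : 0 < a -> Euler_integral (a + 1) = a * Euler_integral a.
Proof.
move=> a0; have := gamma_intS a0.
by rewrite (gamma_intE a0) (gamma_intE (addr_gt0 a0 ltr01)) => -[].
Qed.

Lemma beta_intE a b : 0 < a -> 0 < b ->
  beta_int a b = (Euler_integral a * Euler_integral b / Euler_integral (a + b))%:E.
Proof.
move=> a0 b0; have ab0 := addr_gt0 a0 b0.
have EK (c : R) (u : \bar R) : 0 < c -> ((c^-1)%:E * (c%:E * u) = u)%E.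
  by move=> c0; rewrite muleA -EFinM mulVf ?gt_eqF// mul1e.
rewrite -[LHS](EK (Euler_integral (a + b))) ?Euler_integral_gt0//.
rewrite -(gamma_intE ab0) -gamma_int_beta_int (gamma_intE a0) (gamma_intE b0).
by rewrite -!EFinM mulrC.
Qed.

Lemma Euler_integral_rising a n : 0 < a ->
  Euler_integral (a + n%:R) = Euler_integral a * \prod_(k < n) (a + k%:R).
Proof.
move=> a0; elim: n => [|n IH]; first by rewrite big_ord0 mulr1 addr0.
rewrite -natr1 addrA Euler_integralS; last by rewrite ltr_pwDl.
by rewrite IH big_ord_recr/= mulrCA [X in _ * X]mulrC.
Qed.

(** For [x <= 0], [Gamma x] is defined by the least shift [N] with [0 < x + N];
    the remaining [n - N] steps lie in the positive range, where the recurrence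
    of the Euler integral applies. *)
Lemma Gamma_rising x n : (forall k : nat, x != - k%:R) -> 0 < x + n%:R ->
  Gamma x * \prod_(k < n) (x + k%:R) = Euler_integral (x + n%:R).
Proof.
move=> xk xn; rewrite /Gamma; case: ifPn => x0.
  by rewrite -Euler_integral_rising.
set N := (Num.truncn (- x)).+1.
have x0' : 0 <= - x by rewrite oppr_ge0 leNgt.
have Nn : (N <= n)%N.
  rewrite /N -(@ltr_nat R); apply: le_lt_trans (_ : - x < _).
    by have /andP[] := truncn_itv x0'.
  by rewrite -subr_gt0 opprK addrC.
have xN : 0 < x + N%:R.
  by have /andP[_] := truncn_itv x0'; rewrite -subr_gt0 opprK addrC.
move: xn; rewrite -(subnKC Nn); move: (n - N)%N => j _.
rewrite natrD addrA (Euler_integral_rising j xN) big_split_ord/=.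
under [X in _ * (_ * X) = _]eq_bigr do rewrite natrD addrA.
rewrite mulrA divfK//.
by apply/prodf_neq0 => k _; rewrite -(opprK k%:R) subr_eq0.
Qed.

End GammaRecurrence.

(** * Fractional derivatives of powers of the distance to the base point *)

Section FractionalDerivativeOfPowers.
Context {R : realType}.
Local Notation mu := (@lebesgue_measure R).
Implicit Types a b c p q t u x y z : R.

(** This family is stable under differentiation off [0]: one derivative lowers
    [p] and raises [k] by one, because [Num.sg] is the derivative of the
    absolute value. *)
Definition signed_pow p (k : nat) y : R := `|y| `^ p * Num.sg y ^+ k.

Lemma is_derive_signed_pow p k y : y != 0 ->
  is_derive y 1 (signed_pow p k) (p * signed_pow (p - 1) k.+1 y).
Proof.
rewrite neq_lt /signed_pow => /orP[y0|y0].
- have H : is_derive y 1 (fun u : R => (-1) ^+ k * (- u) `^ p)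
      ((-1) ^+ k * (p * (- y) `^ (p - 1) * -1)).
    have ny0 : 0 < - y by rewrite oppr_gt0.
    have HN : is_derive y 1 (-%R : R -> R) (-1) by exact: is_deriveNid.
    exact (is_deriveZ ((-1) ^+ k) (is_derive1_comp (is_derive1_powR p ny0) HN)).
  apply: near_eq_is_derive; last first.
    apply: (is_derive_eq H).
    by rewrite ltr0_norm// ltr0_sg// exprS; ring.
  near=> u; have u0 : u < 0 by near: u; exact: lt_nbhsl.
  by rewrite ltr0_norm// ltr0_sg// mulrC.
- apply: near_eq_is_derive; last first.
    apply: (is_derive_eq (is_derive1_powR p y0)).
    by rewrite gtr0_norm// gtr0_sg// expr1n mulr1.
  near=> u; have u0 : 0 < u by near: u; exact: lt_nbhsr.
  by rewrite gtr0_norm// gtr0_sg// expr1n mulr1.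
Unshelve. all: by end_near. Qed.

Lemma derive1n_signed_pow b c p k n (F : R -> R) :
  (forall u, u != b -> F u = c * signed_pow p k (u - b)) ->
  forall u, u != b -> derive1n n F u =
    c * \prod_(i < n) (p - i%:R) * signed_pow (p - n%:R) (k + n) (u - b).
Proof.
move=> FE; elim: n => [|n IH] u ub.
  by rewrite big_ord0 mulr1 subr0 addn0 derive1n0 FE.
have HB : is_derive u 1 (fun v : R => v - b) 1.
  by rewrite -[X in is_derive _ _ _ X]subr0; exact: is_deriveB.
have ub0 : u - b != 0 by rewrite subr_eq0.
pose C := c * \prod_(i < n) (p - i%:R).
have H : is_derive u 1 (fun v => C * signed_pow (p - n%:R) (k + n) (v - b))
    (C * ((p - n%:R) * signed_pow (p - n%:R - 1) (k + n).+1 (u - b) * 1)).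
  exact (is_deriveZ C (@is_derive1_comp _ _ (fun v => v - b) _ _ _
    (is_derive_signed_pow (p - n%:R) (k + n) ub0) HB)).
rewrite derive1nS derive1E.
transitivity ('D_1 (fun v => C * signed_pow (p - n%:R) (k + n) (v - b)) u).
  apply: near_eq_derive; near=> v; apply: IH; near: v.
  by apply: open_nbhs_nbhs; split=> //; exact: open_neq.
have [_ ->] := H.
rewrite big_ord_recr/= mulr1 addnS /C !mulrA -addrA -opprD natr1.
by [].
Unshelve. all: by end_near. Qed.

Lemma integral_truncpow_itv a q b x :
  (\int[mu]_t (truncpow (a - 1) (t - b) * truncpow (q - 1) (x - t))%:E =
   (truncpow (a + q - 1) (x - b))%:E * beta_int a q)%E.
Proof.
pose f t := (truncpow (a - 1) t * truncpow (q - 1) (x - b - t))%:E.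
transitivity (\int[mu]_t f (1 * t - b)%R)%E.
  apply: eq_integral => t _; rewrite /f mul1r.
  by congr (_ * truncpow _ _)%:E; ring.
have mf : measurable_fun [set: R] f.
  by apply/measurable_EFinP; exact: measurable_truncpow_conv.
have f0 t : (0 <= f t)%E by rewrite lee_fin mulr_ge0// truncpow_ge0.
by rewrite (ge0_integral_affine (- b) ltr01 mf f0) invr1 mul1e truncpow_conv.
Qed.

Lemma integral_truncpow_itvN a q b x :
  (\int[mu]_t (truncpow (a - 1) (b - t) * truncpow (q - 1) (t - x))%:E =
   (truncpow (a + q - 1) (b - x))%:E * beta_int a q)%E.
Proof.
pose f t := (truncpow (a - 1) (t - - b) * truncpow (q - 1) (- x - t))%:E.
transitivity (\int[mu]_t f (- t)%R)%E.
  apply: eq_integral => t _; rewrite /f.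
  by congr (truncpow _ _ * truncpow _ _)%:E; ring.
rewrite (@ge0_integral_reflect _ f)//.
- by rewrite integral_truncpow_itv opprK [- x + b]addrC.
- apply/measurable_EFinP; apply: measurable_funM.
    apply: measurableT_comp; first exact: measurable_truncpow.
    exact: measurable_funB.
  apply: measurableT_comp; first exact: measurable_truncpow.
  exact: measurable_funB.
- by move=> t; rewrite lee_fin mulr_ge0// truncpow_ge0.
Qed.

(** The endpoints of the interval are excluded from the comparison, since there
    [h] and [g] may differ: [0 `^ 0] is [1] while [truncpow 0 0] is [0]. *)
Lemma Rintegral_itv_eq_scale a b c I (h g : R -> R) :
  measurable_fun [set: R] g -> (forall t, 0 <= g t) ->
  (\int[mu]_t (g t)%:E = I%:E)%E ->
  (forall t, a < t < b -> h t = c * g t) ->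
  (forall t, ~~ (a < t < b) -> g t = 0) ->
  \int[mu]_(t in `[a, b]) h t = c * I.
Proof.
move=> mg g0 gI hg gout; rewrite /Rintegral.
have mcg : measurable_fun [set: R] (fun t => c * g t) by exact: measurable_funM.
have hgi : {in `]a, b[%classic, (fun t => c * g t) =1 h}.
  by move=> t; rewrite inE/= in_itv/= => abt; rewrite hg.
rewrite integral_itv_bndoo; last first.
  apply/measurable_EFinP; apply: eq_measurable_fun hgi _.
  exact: measurable_funTS.
rewrite (_ : (\int[mu]_(t in _) _ = c%:E * I%:E)%E)//.
rewrite -gI -integralZl//; last first.
  apply/integrableP; split; first exact/measurable_EFinP.
  under eq_integral do rewrite gee0_abs ?lee_fin//.
  by rewrite gI ltry.
rewrite [LHS]integral_mkcond; apply: eq_integral => t _.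
rewrite patchE mem_setE in_itv/=; case: ifPn => abt; first by rewrite hg// EFinM.
by rewrite gout// mule0.
Qed.


Lemma frac_kernelE (n m : nat) beta y : y != 0 ->
  y ^+ n * `|y| `^ (- beta - 1) * Num.sg y ^+ m =
  `|y| `^ (n%:R - beta - 1) * Num.sg y ^+ (n + m).
Proof.
move=> y0; rewrite {1}(numEsg y) exprMn -(@powR_mulrn _ `|y|)//.
rewrite (_ : n%:R - beta - 1 = n%:R + (- beta - 1)); last by ring.
rewrite (@powRD _ _ n%:R (- beta - 1)) ?normr_eq0 ?y0 ?implybT// exprD; ring.
Qed.

(** To the right of the base point the integral is a convolution of truncated
    powers. To the left, reflection gives the same convolution, and the
    orientation together with the odd powers of [x - t] gives the sign
    [(-1) ^+ (n + m)], which is the sign recorded by [signed_pow]. *)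
Lemma oriented_integral_pow (n m : nat) beta gam c b x :
  (0 < n)%N -> beta < n%:R -> - 1 < gam -> x != b ->
  oriented_integral b x (fun t => c * `|t - b| `^ gam * (x - t) ^+ n *
    `|x - t| `^ (- beta - 1) * Num.sg (x - t) ^+ m.+1) =
  c * (Euler_integral (gam + 1) * Euler_integral (n%:R - beta) /
       Euler_integral (gam + 1 + (n%:R - beta))) *
    signed_pow (gam + n%:R - beta) (n + m) (x - b).
Proof.
move=> n0 bn gam1 xb.
set q := n%:R - beta; set B := (X in c * X * _).
have q0 : 0 < q by rewrite subr_gt0.
have g0 : 0 < gam + 1 by lra.
have BE : beta_int (gam + 1) q = B%:E by rewrite beta_intE.
have trunc_out y z r s t : ~~ (y < t < z) ->
    truncpow r (t - y) * truncpow s (z - t) = 0.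
  rewrite negb_and -!leNgt => /orP[ty|zt]; first by rewrite le0_truncpow ?mul0r ?subr_le0.
  by rewrite [X in _ * X]le0_truncpow ?mulr0 ?subr_le0.
have mtrunc y z r s : measurable_fun [set: R]
    (fun t => truncpow r (t - y) * truncpow s (z - t)).
  apply: measurable_funM.
    apply: measurableT_comp; first exact: measurable_truncpow.
    exact: measurable_funB.
  apply: measurableT_comp; first exact: measurable_truncpow.
  exact: measurable_funB.
rewrite /oriented_integral /signed_pow; move: xb; rewrite neq_lt => /orP[xb|bx].
- rewrite leNgt xb/= ltr0_norm ?subr_lt0// ltr0_sg ?subr_lt0// opprB.
  rewrite (@Rintegral_itv_eq_scale x b (c * (-1) ^+ (n + m.+1))
    ((b - x) `^ (gam + 1 + q - 1) * B) _
    (fun t => truncpow (q - 1) (t - x) * truncpow (gam + 1 - 1) (b - t)))//.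
  + rewrite addnS exprS (_ : gam + 1 + q - 1 = gam + n%:R - beta); last by rewrite /q; ring.
    by ring.
  + by move=> t; rewrite mulr_ge0// truncpow_ge0.
  + under eq_integral do rewrite mulrC.
    by rewrite integral_truncpow_itvN BE gt0_truncpow ?subr_gt0.
  + move=> t /andP[xt tb].
    rewrite -!mulrA [_ ^+ n * _]mulrA frac_kernelE ?subr_eq0 ?lt_eqF//.
    rewrite !gt0_truncpow ?subr_gt0// addrK ltr0_norm ?subr_lt0// opprB.
    rewrite ltr0_norm ?subr_lt0// opprB ltr0_sg ?subr_lt0//.
    by rewrite /q; ring.
  + by move=> t; exact: trunc_out.
- rewrite (ltW bx) gtr0_norm ?subr_gt0// gtr0_sg ?subr_gt0// expr1n mulr1.
  rewrite (@Rintegral_itv_eq_scale b x c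
    ((x - b) `^ (gam + 1 + q - 1) * B) _
    (fun t => truncpow (gam + 1 - 1) (t - b) * truncpow (q - 1) (x - t)))//.
  + rewrite (_ : gam + 1 + q - 1 = gam + n%:R - beta); last by rewrite /q; ring.
    by ring.
  + by move=> t; rewrite mulr_ge0// truncpow_ge0.
  + by rewrite integral_truncpow_itv BE gt0_truncpow ?subr_gt0.
  + move=> t /andP[bt tx].
    rewrite -!mulrA [_ ^+ n * _]mulrA frac_kernelE ?subr_eq0 ?gt_eqF//.
    rewrite !gt0_truncpow ?subr_gt0// addrK !gtr0_norm ?subr_gt0//.
    by rewrite gtr0_sg ?subr_gt0// expr1n mulr1.
  + by move=> t; exact: trunc_out.
Qed.

(** By [Gamma_rising] this is [Gamma (gam + 1) / Gamma (gam - beta + 1)]; the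
    product form also gives the right value, zero, at the poles of the
    denominator, for instance for [gam = 0] and a positive integer [beta]. *)
Definition frac_pow_coef beta gam : R :=
  let n := (Num.truncn beta).+1 in
  Euler_integral (gam + 1) / Euler_integral (gam - beta + 1 + n%:R) *
    \prod_(k < n) (gam - beta + 1 + k%:R).

(** The [n] ordinary derivatives lower the exponent [gam + n - beta] to
    [gam - beta] and raise the sign exponent [n + m] by [n], an even change of
    [n + n] in total; [Gamma (n - beta)] cancels against the beta integral. *)
Lemma frac_derive_pow m beta gam c b x : 0 <= beta -> - 1 < gam -> x != b ->
  frac_derive m beta b (fun t => c * `|t - b| `^ gam) x =
  c * frac_pow_coef beta gam * signed_pow (gam - beta) m (x - b).
Proof.
move=> beta0 gam1 xb; rewrite /frac_derive /frac_pow_coef.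
have /andP[_] := truncn_itv beta0; set n := (Num.truncn beta).+1 => bn.
have n0 : (0 < n)%N by [].
have q0 : 0 < n%:R - beta by rewrite subr_gt0.
have GammaE : Gamma (n%:R - beta) = Euler_integral (n%:R - beta).
  by rewrite /Gamma q0.
rewrite GammaE (@derive1n_signed_pow b (c * (Euler_integral (gam + 1) *
    Euler_integral (n%:R - beta) / Euler_integral (gam + 1 + (n%:R - beta))))
    (gam + n%:R - beta) (n + m) n); [|move=> u ub|by []]; last first.
  by rewrite oriented_integral_pow.
have Eq := lt0r_neq0 (Euler_integral_gt0 q0).
rewrite (_ : gam + 1 + (n%:R - beta) = gam - beta + 1 + n%:R); last by ring.
rewrite (_ : gam + n%:R - beta - n%:R = gam - beta); last by ring.
rewrite (_ : signed_pow _ _ _ = signed_pow (gam - beta) m (x - b)); last first.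
  congr (_ * _); rewrite addnAC addnn exprD.
  by rewrite -mul2n exprM sqr_sg subr_eq0 xb expr1n mul1r.
rewrite (_ : \prod_(i < n) (gam + n%:R - beta - i%:R) =
    \prod_(k < n) (gam - beta + 1 + k%:R)); last first.
  rewrite (reindex_inj rev_ord_inj)/=; apply: eq_bigr => k _.
  by rewrite natrB// -natr1; ring.
have cancel_q (C e1 q e2V r s : R) : q != 0 ->
    q^-1 * (C * (e1 * q * e2V) * r * s) = C * (e1 * e2V * r) * s.
  by move=> qN0; field.
exact: cancel_q.
Qed.

End FractionalDerivativeOfPowers.

(** * Powers of a linear form, with a finite or an infinite base point *)

Section ExtendedBasePoint.
Context {R : realType}.
Implicit Types a b c p q t u v x y z : R.

Lemma cvg_powRN (F : set_system R) {FF : Filter F} (g : R -> R) beta : 0 < beta ->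
  (forall M, \forall b \near F, M < g b) -> g b `^ (- beta) @[b --> F] --> (0 : R).
Proof.
move=> beta0 gF; apply/cvgr0Pnorm_lt => e e0.
near=> b.
have gb0 : 0 < g b by near: b; exact: gF.
rewrite ger0_norm ?powR_ge0// powRN -[ltRHS]invrK ltf_pV2 ?posrE ?invr_gt0 ?powR_gt0//.
have ge : e^-1 `^ beta^-1 < g b by near: b; exact: gF.
have e1 : 0 <= e^-1 by rewrite invr_ge0 ltW.
have {1}-> : e^-1 = (e^-1 `^ beta^-1) `^ beta.
  by rewrite -powRrM mulVf ?gt_eqF// powRr1.
by apply: gt0_ltr_powR; rewrite ?nnegrE ?powR_ge0// ltW.
Unshelve. all: by end_near. Qed.

Lemma frac_pow_coef_0 (gam : R) : - 1 < gam -> frac_pow_coef 0 gam = 1.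
Proof.
move=> gam1; rewrite /frac_pow_coef truncn0 big_ord1 addr0 subr0.
have g0 : 0 < gam + 1 by lra.
rewrite (Euler_integralS g0).
by field; rewrite (lt0r_neq0 g0) lt0r_neq0// Euler_integral_gt0.
Qed.

Lemma frac_derive_cst m beta c b x : 0 <= beta -> x != b ->
  frac_derive m beta b (fun=> c) x =
  c * frac_pow_coef beta 0 * signed_pow (- beta) m (x - b).
Proof.
move=> beta0 xb; have -> : (fun=> c) = (fun t => c * `|t - b| `^ 0).
  by apply/funext => t; rewrite powRr0 mulr1.
by rewrite (frac_derive_pow m c beta0 (ltrN10 R) xb) add0r.
Qed.

(** [sgn] tells from which side of [x] the base point is seen at infinity. For
    [0 < beta] the derivative of a constant decays like a negative power of the
    distance to the base point; for [beta = 0] it is the constant times a sign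
    that depends on that side only. *)
Lemma lim_frac_derive_cst (F : set_system R) {FF : ProperFilter F} m beta c sgn x :
  0 <= beta -> (forall M, \forall b \near F, M < sgn * (x - b)) -> `|sgn| = 1 ->
  lim (frac_derive m beta b (fun=> c) x @[b --> F]) = (beta == 0)%:R * (c * sgn ^+ m).
Proof.
move=> beta0 xF sgn1; apply: cvg_lim => //.
have sgn2 : sgn * sgn = 1 by rewrite -expr2 -real_normK ?num_real// sgn1 expr1n.
have E : \forall b \near F, c * frac_pow_coef beta 0 *
    ((sgn * (x - b)) `^ (- beta) * sgn ^+ m) = frac_derive m beta b (fun=> c) x.
  near=> b; have xb : 0 < sgn * (x - b) by near: b; exact: xF.
  have xbE : x - b = sgn * (sgn * (x - b)) by rewrite mulrA sgn2 mul1r.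
  have sgnE : Num.sg sgn = sgn by rewrite [RHS]numEsg sgn1 mulr1.
  rewrite frac_derive_cst//; last first.
    by apply/eqP => xb0; move: xb; rewrite xb0 subrr mulr0 ltxx.
  rewrite /signed_pow {2 3}xbE normrM sgn1 mul1r gtr0_norm//.
  by rewrite sgrM sgnE (gtr0_sg xb) mulr1.
apply: cvg_trans (near_eq_cvg E) _.
have [->|beta1] := eqVneq beta 0.
  rewrite mul1r frac_pow_coef_0 ?ltrN10// mulr1 oppr0.
  under eq_fun do rewrite powRr0 mul1r.
  exact: cvg_cst.
have : c * frac_pow_coef beta 0 * ((sgn * (x - b)) `^ (- beta) * sgn ^+ m)
    @[b --> F] --> c * frac_pow_coef beta 0 * (0 * sgn ^+ m).
  apply: cvgMr; apply: cvgMl.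
  by apply: cvg_powRN => //; rewrite lt0r beta1.
by rewrite !mul0r mulr0.
Unshelve. all: by end_near. Qed.

Definition frac_line_pow alpha beta m p q u v : R :=
  efrac_derive m beta (- (q * v)%:E / u%:E)%E
    (fun t => `|t * u + q * v| `^ alpha) p.

Lemma frac_line_pow_finite alpha beta m p q u v :
  -1 < alpha -> 0 <= beta -> u != 0 -> p * u + q * v != 0 ->
  frac_line_pow alpha beta m p q u v = frac_pow_coef beta alpha *
    (`|u| `^ beta * `|p * u + q * v| `^ (alpha - beta) *
     Num.sg (u * (p * u + q * v)) ^+ m).
Proof.
move=> alpha1 beta0 u0 w0; rewrite /frac_line_pow inver (negbTE u0)/=.
set b := - (q * v) / u.
have bE t : t * u + q * v = u * (t - b) by rewrite /b; field.
under [X in frac_derive _ _ _ X]eq_fun do rewrite bE normrM powRM//.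
have pb : p != b by move: w0; rewrite bE mulf_eq0 negb_or subr_eq0 => /andP[].
rewrite (frac_derive_pow _ _ beta0 alpha1 pb) bE /signed_pow normrM powRM//.
have -> : `|u| `^ alpha = `|u| `^ beta * `|u| `^ (alpha - beta).
  by rewrite -powRD ?normr_eq0 ?u0 ?implybT//; congr powR; ring.
have -> : Num.sg (u * (u * (p - b))) = Num.sg (p - b).
  by rewrite !sgrM mulrA -expr2 sqr_sg u0 mul1r.
by ring.
Qed.

(** When [u = 0] the power of the linear form is constant in [p], and the base
    point is [-oo] or [+oo] according to the sign of [q * v]. *)
Lemma frac_line_pow_infinite alpha beta m p q v :
  0 <= beta -> q * v != 0 ->
  frac_line_pow alpha beta m p q 0 v =
  (beta == 0)%:R * (`|q * v| `^ alpha * Num.sg (q * v) ^+ m).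
Proof.
move=> beta0; rewrite /frac_line_pow inve0.
under [X in efrac_derive _ _ _ X]eq_fun do rewrite mulr0 add0r.
rewrite neq_lt => /orP[qv0|qv0].
- rewrite gt0_muley ?lte_fin ?oppr_gt0//= (ltr0_sg qv0).
  apply: lim_frac_derive_cst; rewrite ?normrN1// => M.
  near=> b; rewrite mulN1r opprB ltrBrDr; near: b; apply: nbhs_pinfty_gt; exact: num_real.
- rewrite lt0_muley ?lte_fin ?oppr_lt0//= (gtr0_sg qv0).
  apply: lim_frac_derive_cst; rewrite ?normr1// => M.
  near=> b; rewrite mul1r ltrBrDr -ltrBrDl; near: b; apply: nbhs_ninfty_lt; exact: num_real.
Unshelve. all: by end_near. Qed.

(** For [u = 0], [beta = 0] and [m = 1], the infinite base point contributes a
    term of the sign of [q * v], whereas the closed formula for finite base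
    points vanishes through [Num.sg 0]. The last summand is this discrepancy. *)
Lemma frac_line_powE alpha beta m p q u v :
  0 < alpha -> 0 <= beta -> (m <= 1)%N -> p * u + q * v != 0 ->
  frac_line_pow alpha beta m p q u v =
  frac_pow_coef beta alpha *
    (`|u| `^ beta * `|p * u + q * v| `^ (alpha - beta) *
     Num.sg (u * (p * u + q * v)) ^+ m) +
  ((u == 0) && (beta == 0) && (m == 1))%:R * (`|q * v| `^ alpha * Num.sg (q * v)).
Proof.
move=> alpha0 beta0 m1 w0.
have alpha1 : -1 < alpha by lra.
have [u0|u0] := eqVneq u 0; last by rewrite mul0r addr0 frac_line_pow_finite.
move: w0; rewrite u0 mulr0 add0r => qv0.
rewrite frac_line_pow_infinite// normr0 mul0r sgr0.
have [->|beta1] := eqVneq beta 0; last by rewrite powR0// !(mul0r, mulr0) addr0.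
rewrite frac_pow_coef_0// powRr0 subr0 !mul1r.
by case: m m1 => [|[|]]//= _; rewrite ?expr0 ?expr1 ?mulr1 ?mul1r ?mul0r ?mulr0 ?addr0 ?add0r.
Qed.

End ExtendedBasePoint.

(** * Passage to the limit under the integral *)

Section KernelBounds.
Context {R : realType}.
Implicit Types (alpha beta p q r u v x y : R) (m : nat).

(** The covariation kernel on the half of the circle where [`|u| <= `|v|]; the
    other half is obtained by exchanging the coordinates. *)
Definition half_kernel alpha beta m u v : R :=
  `|u| `^ beta * `|v| `^ (alpha - beta) * Num.sg (u * v) ^+ m.

Lemma half_le_norm u v : u ^+ 2 + v ^+ 2 = 1 -> `|u| <= `|v| -> 2^-1 <= `|v|.
Proof.
move=> uv1 uv; rewrite leNgt; apply/negP => v2.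
have := real_normK (num_real u); have := real_normK (num_real v).
have := normr_ge0 u; have := normr_ge0 v; nra.
Qed.

(** One bound for both signs of the exponent: the first summand serves
    [0 <= r], the second one [r < 0]. *)
Lemma powR_le_half r y : 2^-1 <= y -> y <= 1 -> y `^ r <= 1 + 2^-1 `^ r.
Proof.
move=> y2 y1; have y0 : 0 < y by lra.
have [r0|r0] := leP 0 r.
  rewrite ler_wpDr ?powR_ge0//.
  have -> : (1 : R) = 1 `^ r by rewrite powR1.
  by apply: ge0_ler_powR; rewrite ?nnegrE//; lra.
rewrite ler_wpDl// -[r]opprK !(powRN _ (- r)) lef_pV2 ?posrE ?powR_gt0 ?invr_gt0//.
by apply: ge0_ler_powR; rewrite ?nnegrE//; lra.
Qed.

Lemma norm_sg_le1 x m : `|Num.sg x ^+ m| <= 1.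
Proof. by rewrite normrX normr_sg exprn_ile1 ?ler0n// lern1 leq_b1. Qed.

Lemma half_kernel_bounded alpha beta m u v : 0 <= beta ->
  u ^+ 2 + v ^+ 2 = 1 -> `|u| <= `|v| ->
  `|half_kernel alpha beta m u v| <= 1 + 2^-1 `^ (alpha - beta).
Proof.
move=> beta0 uv1 uv; rewrite /half_kernel !normrM !(ger0_norm (powR_ge0 _ _)).
have v1 : `|v| <= 1.
  by rewrite -(@expr_le1 _ 2)// real_normK ?num_real// -uv1 ler_wpDl// sqr_ge0.
have u1 : `|u| `^ beta <= 1.
  have -> : (1 : R) = 1 `^ beta by rewrite powR1.
  by rewrite ge0_ler_powR ?nnegrE// (le_trans uv).
rewrite -[leRHS]mulr1; apply: ler_pM; rewrite ?norm_sg_le1 ?mulr_ge0 ?powR_ge0//.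
rewrite -[leRHS]mul1r; apply: ler_pM; rewrite ?powR_ge0//.
exact/powR_le_half/v1/(half_le_norm uv1).
Qed.

Lemma powR_near1 r e : 0 < e ->
  exists2 d : R, 0 < d & forall x, `|x - 1| < d -> `|x `^ r - 1| < e.
Proof.
move=> e0.
have [/derivable1_diffP/differentiable_continuous + _] := is_derive1_powR r (@ltr01 R).
move=> /cvgrPdist_lt/(_ _ e0); rewrite powR1 => /nbhs_ballP[d d0 xd].
exists d => // x x1; rewrite distrC; apply: xd.
by rewrite /ball/= distrC.
Qed.

End KernelBounds.

Section Measurability.
Context d (T : measurableType d) {R : realType}.

Lemma measurable_fun_sgr (f : T -> R) :
  measurable_fun [set: T] f -> measurable_fun [set: T] (fun t => Num.sg (f t)).
Proof.
move=> mf; rewrite (_ : (fun t => _) = (fun t =>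
    if f t == 0 then 0 else if f t < 0 then -1 else 1)); last first.
  by apply/funext => t; rewrite /Num.sg/=; case: sgrP.
apply: measurable_fun_ifT => //; first exact: measurable_fun_eqr.
by apply: measurable_fun_ifT => //; exact: measurable_fun_ltr.
Qed.

Lemma measurable_fun_normr_powR (f : T -> R) r :
  measurable_fun [set: T] f -> measurable_fun [set: T] (fun t => `|f t| `^ r).
Proof.
move=> mf; apply: (@measurableT_comp _ _ _ _ _ _ (@powR R ^~ r) _ (fun t => `|f t|)).
  exact: measurable_powR.
exact: measurableT_comp.
Qed.

Lemma le_bounded_integrable (mu : {finite_measure set T -> \bar R}) (D : set T)
    (f : T -> R) M : measurable D -> measurable_fun [set: T] f ->
  (forall t, D t -> `|f t| <= M) -> mu.-integrable D (EFin \o f).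
Proof.
move=> mD mf fM; apply: measurable_bounded_integrable => //.
- by rewrite -ge0_fin_numE// fin_num_measure.
- exact: measurable_funTS.
- exists M; split; first exact: num_real.
  by move=> x Mx t Dt; exact: le_trans (fM t Dt) (ltW Mx).
Qed.

End Measurability.

Section LimitOfIntegrals.
Context d (T : measurableType d) {R : realType}.
Variables (mu : {finite_measure set T -> \bar R}) (D : set T).
Variables (u v : T -> R) (alpha beta : R) (m : nat).
Hypotheses (mD : measurable D) (mfu : measurable_fun [set: T] u).
Hypothesis mfv : measurable_fun [set: T] v.
Hypothesis uv1 : forall t, D t -> u t ^+ 2 + v t ^+ 2 = 1.
Hypothesis uv : forall t, D t -> `|u t| <= `|v t|.
Hypothesis (alpha0 : 0 < alpha) (beta0 : 0 <= beta) (m1 : (m <= 1)%N).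
Hypothesis balanced :
  \int[mu]_(t in D) (if u t == 0 then Num.sg (v t) else 0) = 0.

Let C := frac_pow_coef beta alpha.
Let K t := half_kernel alpha beta m (u t) (v t).

(** With [rho = q + p * (u / v)], the linear form [p * u + q * v] is [v * rho],
    and [rho] is uniformly close to [1] because [`|u / v| <= 1]. The closed form
    of the derivative is therefore [C * K] times [rho `^ (alpha - beta)], which
    is uniformly close to [1] too, plus the discrepancy of [frac_line_powE],
    which has integral zero by [balanced]. *)
Lemma integral_frac_line_pow_near (e : R) : 0 < e ->
  exists2 del : R, 0 < del & forall p q, `|p| < del -> `|q - 1| < del ->
    let F := fun t => frac_line_pow alpha beta m p q (u t) (v t) in
    mu.-integrable D (EFin \o F) /\
    `|C * \int[mu]_(t in D) K t - \int[mu]_(t in D) F t| < e.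
Proof.
move=> e0.
pose M : R := 1 + 2^-1 `^ (alpha - beta).
have M0 : 0 <= M by rewrite addr_ge0// powR_ge0.
pose muD : R := fine (mu D).
have muD0 : 0 <= muD by rewrite fine_ge0.
(* The [+ 1] keeps [N] positive when [C] or the mass of [D] vanishes. *)
pose N := `|C| * M * muD + 1.
have N0 : 0 < N by rewrite ltr_wpDl// !mulr_ge0.
have e'0 : 0 < e / N by rewrite divr_gt0.
have [eta eta0 pow_near1] := powR_near1 (alpha - beta) e'0.
(* [eta / 2] bounds each of the two terms of [rho - 1]; [4^-1] keeps [q] and
   [rho] positive. *)
pose del := Num.min (eta / 2) 4^-1.
have del0 : 0 < del by rewrite lt_min divr_gt0//= invr_gt0.
exists del => // p q; rewrite !lt_min => /andP[p1 p2] /andP[q1 q2] F.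
pose K' t := `|u t| `^ beta * `|p * u t + q * v t| `^ (alpha - beta) *
  Num.sg (u t * v t) ^+ m.
pose h t := if u t == 0 then Num.sg (v t) else 0.
pose c := ((beta == 0) && (m == 1%N))%:R * q `^ alpha.
have v2 t : D t -> 2^-1 <= `|v t| by move=> Dt; exact: half_le_norm (uv1 Dt) (uv Dt).
pose rho t := q + p * (u t / v t).
have v0 t : D t -> v t != 0.
  by move=> Dt; rewrite -normr_gt0 (lt_le_trans _ (v2 t Dt))// invr_gt0.
have rhoE t : D t -> p * u t + q * v t = v t * rho t.
  by move=> Dt; rewrite /rho; field; exact: v0.
have uv_le t : D t -> `|p * (u t / v t)| <= `|p|.
  move=> Dt; rewrite normrM -[leRHS]mulr1 ler_wpM2l// normrM normfV.
  by rewrite ler_pdivrMr ?mul1r ?uv// normr_gt0 v0.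
have rho_eta t : D t -> `|rho t - 1| < eta.
  move=> Dt; rewrite /rho addrAC (le_lt_trans (ler_normD _ _))//.
  by have := uv_le t Dt; lra.
have rho0 t : D t -> 0 < rho t.
  move=> Dt; have := uv_le t Dt; move: q2; rewrite /rho.
  by rewrite ltr_norml ler_norml => /andP[? _] /andP[? _]; lra.
have K'E t : D t -> K' t = K t * rho t `^ (alpha - beta).
  move=> Dt; rewrite /K' rhoE// normrM (gtr0_norm (rho0 t Dt)) powRM// ?(ltW (rho0 t Dt))//.
  by rewrite /K /half_kernel; ring.
have FE t : D t -> F t = C * K' t + c * h t.
  move=> Dt; rewrite /F frac_line_powE//; last by rewrite rhoE// mulf_neq0 ?v0 ?gt_eqF ?rho0.
  have -> : Num.sg (u t * (p * u t + q * v t)) = Num.sg (u t * v t).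
    by rewrite rhoE// mulrA sgrM (gtr0_sg (rho0 t Dt)) mulr1.
  congr (_ + _).
  rewrite /c /h -andbA; case: eqVneq => ut0 /=; last by rewrite mul0r mulr0.
  have q0 : 0 < q by move: q2; rewrite ltr_norml; lra.
  rewrite normrM powRM// sgrM (gtr0_norm q0) (gtr0_sg q0) mul1r.
  have -> : `|v t| = 1.
    apply/eqP; rewrite -(@eqrXn2 _ 2)// expr1n real_normK ?num_real//.
    by rewrite -(uv1 Dt) ut0 expr0n add0r.
  by rewrite powR1 mulr1 mulrA.
have mK' : measurable_fun [set: T] K'.
  apply: measurable_funM.
    apply: measurable_funM; first exact: measurable_fun_normr_powR.
    apply: measurable_fun_normr_powR.
    by apply: measurable_funD; exact: measurable_funM.
  by apply: measurable_funX; apply: measurable_fun_sgr; exact: measurable_funM.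
have mK : measurable_fun [set: T] K.
  apply: measurable_funM.
    by apply: measurable_funM; exact: measurable_fun_normr_powR.
  by apply: measurable_funX; apply: measurable_fun_sgr; exact: measurable_funM.
have mh : measurable_fun [set: T] h.
  apply: measurable_fun_ifT => //; first exact: measurable_fun_eqr.
  exact: measurable_fun_sgr.
have KM t : D t -> `|K t| <= M by move=> Dt; apply: half_kernel_bounded; auto.
have iK : mu.-integrable D (EFin \o K) by exact: le_bounded_integrable KM.
have KK'M t : D t -> `|K t - K' t| <= M * (e / N).
  move=> Dt; rewrite K'E// -{1}(mulr1 (K t)) -mulrBr normrM ler_pM ?KM//.
  by rewrite distrC ltW// pow_near1// rho_eta.
have iK' : mu.-integrable D (EFin \o K').
  apply: (@le_bounded_integrable _ _ _ mu D K' (M + M * (e / N))) => // t Dt.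
  have := KK'M t Dt; have := KM t Dt; have := ler_dist_normD; rewrite !ler_norml; lra.
have ih : mu.-integrable D (EFin \o h).
  apply: (@le_bounded_integrable _ _ _ mu D h 1) => // t Dt.
  by rewrite /h; case: ifP => _; rewrite ?normr0// -[Num.sg _]expr1 norm_sg_le1.
have iCK' : mu.-integrable D (EFin \o (fun t => C * K' t)).
  exact: (integrableZl mD C iK').
have ich : mu.-integrable D (EFin \o (fun t => c * h t)).
  exact: (integrableZl mD c ih).
split.
  apply: eq_integrable (integrableD mD iCK' ich) => // t.
  by rewrite inE => Dt /=; rewrite FE.
have -> : \int[mu]_(t in D) F t = C * \int[mu]_(t in D) K' t.
  rewrite (eq_Rintegral _ (g := fun t => C * K' t + c * h t)); last first.
    by move=> t; rewrite inE => Dt; rewrite FE.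
  rewrite RintegralD// !RintegralZl//.
  by rewrite [X in _ + _ * X]balanced mulr0 addr0.
rewrite -mulrBr -RintegralB// normrM.
have iKK' : mu.-integrable D (EFin \o (fun t => K t - K' t)).
  exact: (integrableB mD iK iK').
have norm_le : `|\int[mu]_(t in D) (K t - K' t)| <= M * (e / N) * muD.
  rewrite (le_trans (le_normr_Rintegral mD iKK'))// -Rintegral_cst//.
  apply: le_Rintegral => //.
    exact: integrable_norm.
  by apply: (@le_bounded_integrable _ _ _ mu D _ `|M * (e / N)|).
apply: (@le_lt_trans _ _ (`|C| * (M * (e / N) * muD))); first by rewrite ler_wpM2l.
rewrite (_ : _ * _ = (`|C| * M * muD) * (e / N)); last by ring.
rewrite -[ltRHS](divfK (lt0r_neq0 N0)) [ltRHS]mulrC ltr_pM2r//.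
by rewrite /N ltrDl.
Qed.

End LimitOfIntegrals.

(** * Symmetric measures on the circle *)

Section SymmetricMeasure.
Context {R : realType}.
Implicit Type Gam : {finite_measure set (R * R)%type -> \bar R}.

Lemma measurable_fun_opp_pair : measurable_fun [set: R * R] (-%R : R * R -> R * R).
Proof.
have mN (f : R * R -> R) : measurable_fun [set: R * R] f ->
    measurable_fun [set: R * R] (fun s => - f s) by move=> mf; exact: measurableT_comp.
exact: (measurable_fun_pair (mN _ measurable_fst) (mN _ measurable_snd)).
Qed.

Lemma Rintegral_odd_symmetric Gam (D : set (R * R)) (f : R * R -> R) :
  (forall A : set (R * R), measurable A -> Gam (-%R @` A) = Gam A) ->
  measurable D -> (forall s, D (- s) <-> D s) ->
  measurable_fun [set: R * R] f -> Gam.-integrable D (EFin \o f) ->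
  (forall s, f (- s) = - f s) ->
  \int[Gam]_(s in D) f s = 0.
Proof.
move=> Gsym mD Dsym mf intf fodd.
have DE : -%R @^-1` D = D by apply/seteqP; split=> s /= /Dsym.
have int_opp : (\int[Gam]_(s in D) (f s)%:E = \int[Gam]_(s in D) (- f s)%:E)%E.
  pose nu_ : {measure set (R * R) -> \bar R} :=
    pushforward Gam (-%R : R * R -> R * R).
  pose nu := nu_ measurable_fun_opp_pair.
  transitivity (\int[nu]_(s in D) (f s)%:E)%E.
    apply: eq_measure_integral => A mA _.
    have GamN : Gam A = Gam (-%R @^-1` A).
      rewrite -[LHS](Gsym A mA); congr (Gam _).
      apply/seteqP; split=> [_ [s As <-]|s As]/=; first by rewrite opprK.
      by exists (- s) => //; rewrite opprK.
    exact: GamN.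
  rewrite (integral_pushforward measurable_fun_opp_pair)//.
  - by rewrite DE; apply: eq_integral => s _ /=; rewrite fodd.
  - exact/measurable_EFinP.
  - rewrite DE; apply: eq_integrable (integrableN intf) => // s _ /=.
    by rewrite fodd.
have : \int[Gam]_(s in D) f s = - \int[Gam]_(s in D) f s.
  rewrite {1}/Rintegral int_opp; under eq_integral do rewrite EFinN.
  by rewrite integralN//= ?fineN//; exact: integrable_add_def.
by move=> /eqP; rewrite -subr_eq0 opprK -mulr2n mulrn_eq0/= => /eqP.
Qed.

Lemma dnbhs_pair_proper (x y : R) : ProperFilter ((x, y) : R * R)^'.
Proof.
apply: Build_ProperFilter_ex => A /nbhs_ballP[e e0 Ae].
exists (x + e / 2, y); apply: Ae => /=.
  split=> /=; last exact: ballxx.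
  by rewrite /ball/= opprD addNKr normrN gtr0_norm ?divr_gt0// ltr_pdivrMr// ltr_pMr// ltr1n.
by rewrite xpair_eqE negb_and -subr_eq0 addrAC subrr add0r gt_eqF ?divr_gt0.
Qed.

Lemma measurable_unit_circle : measurable (@unit_circle R).
Proof.
have mf : measurable_fun [set: R * R] (fun s : R * R => s.1 ^+ 2 + s.2 ^+ 2).
  by apply: measurable_funD; apply: measurable_funX.
rewrite (_ : unit_circle = (fun s : R * R => s.1 ^+ 2 + s.2 ^+ 2) @^-1` [set 1]).
  by rewrite -[X in measurable X]setTI; exact: mf.
by [].
Qed.

Lemma measurable_circle_le : measurable (@circle_le R).
Proof.
apply: measurableI; first exact: measurable_unit_circle.
have mf : measurable_fun [set: R * R] (fun s : R * R => `|s.1| <= `|s.2|).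
  by apply: measurable_fun_ler; apply: measurableT_comp.
rewrite (_ : [set _ | _] = (fun s : R * R => `|s.1| <= `|s.2|) @^-1` [set true]).
  by rewrite -[X in measurable X]setTI; exact: mf.
by [].
Qed.

Lemma measurable_circle_gt : measurable (@circle_gt R).
Proof.
apply: measurableI; first exact: measurable_unit_circle.
have mf : measurable_fun [set: R * R] (fun s : R * R => `|s.2| < `|s.1|).
  by apply: measurable_fun_ltr; apply: measurableT_comp.
rewrite (_ : [set _ | _] = (fun s : R * R => `|s.2| < `|s.1|) @^-1` [set true]).
  by rewrite -[X in measurable X]setTI; exact: mf.
by [].
Qed.

Lemma circle_leN (s : R * R) : circle_le (- s) <-> circle_le s.
Proof. by rewrite /circle_le /unit_circle/= !sqrrN !normrN. Qed.

Lemma circle_gtN (s : R * R) : circle_gt (- s) <-> circle_gt s.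
Proof. by rewrite /circle_gt /unit_circle/= !sqrrN !normrN. Qed.

Lemma unit_circle_split : unit_circle = circle_le `|` circle_gt :> set (R * R).
Proof.
apply/seteqP; split=> [s s1|s [[]|[]]//].
by case: (leP `|s.1| `|s.2|) => h; [left|right].
Qed.

Lemma circle_disjoint : circle_le `&` circle_gt = set0 :> set (R * R).
Proof.
apply/seteqP; split=> // s [[_ /= le12] [_ /= lt21]].
by move: le12; rewrite leNgt lt21.
Qed.

Lemma symmetric_covariation_split Gam alpha beta m : 0 <= beta ->
  symmetric_covariation Gam alpha beta m =
  \int[Gam]_(s in circle_le) half_kernel alpha beta m s.1 s.2 +
  \int[Gam]_(s in circle_gt) half_kernel alpha beta m s.2 s.1.
Proof.
move=> beta0; rewrite /symmetric_covariation.
have kE (s : R * R) : sc_kernel alpha beta m s =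
    if `|s.1| <= `|s.2| then half_kernel alpha beta m s.1 s.2
    else half_kernel alpha beta m s.2 s.1.
  rewrite /sc_kernel /half_kernel; case: ifP => // _.
  by rewrite [s.2 * s.1]mulrC [_ `^ beta * _]mulrC.
have mk (f g : R * R -> R) : measurable_fun [set: R * R] f ->
    measurable_fun [set: R * R] g ->
    measurable_fun [set: R * R] (fun s => half_kernel alpha beta m (f s) (g s)).
  move=> mf mg; apply: measurable_funM.
    by apply: measurable_funM; exact: measurable_fun_normr_powR.
  by apply: measurable_funX; apply: measurable_fun_sgr; exact: measurable_funM.
have msc : measurable_fun [set: R * R] (sc_kernel alpha beta m).
  rewrite (_ : sc_kernel _ _ _ = fun s : R * R =>
      if `|s.1| <= `|s.2| then half_kernel alpha beta m s.1 s.2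
      else half_kernel alpha beta m s.2 s.1); last by apply/funext => s; exact: kE.
  apply: measurable_fun_ifT; [|exact: mk|exact: mk].
  by apply: measurable_fun_ler; apply: measurableT_comp.
have isc : Gam.-integrable unit_circle (EFin \o sc_kernel alpha beta m).
  apply: (@le_bounded_integrable _ _ _ Gam unit_circle _ (1 + 2^-1 `^ (alpha - beta))) => //.
    exact: measurable_unit_circle.
  move=> s s1; rewrite kE; case: (leP `|s.1| `|s.2|) => h.
    exact: half_kernel_bounded.
  by apply: half_kernel_bounded => //; [rewrite addrC|exact: ltW].
have disj : [disjoint @circle_le R & @circle_gt R]%classic.
  by apply/disj_set2P; exact: circle_disjoint.
rewrite unit_circle_split in isc *.
rewrite (Rintegral_setU measurable_circle_le measurable_circle_gt isc disj).
congr (_ + _); apply: eq_Rintegral => s; rewrite inE => -[_ /= h]; rewrite kE.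
  by rewrite h.
by rewrite leNgt h.
Qed.

(** The integrand is odd. On the circle it charges only the two antipodal points
    with [f s = 0], where [f] is one of the coordinates. *)
Lemma Rintegral_sg_balanced Gam (D : set (R * R)) (f g : R * R -> R) :
  symmetric_on_circle Gam -> measurable D -> (forall s, D (- s) <-> D s) ->
  measurable_fun [set: R * R] f -> measurable_fun [set: R * R] g ->
  (forall s, f (- s) = - f s) -> (forall s, g (- s) = - g s) ->
  \int[Gam]_(s in D) (if f s == 0 then Num.sg (g s) else 0) = 0.
Proof.
move=> [_ Gsym] mD Dsym mf mg fodd godd.
have mh : measurable_fun [set: R * R] (fun s => if f s == 0 then Num.sg (g s) else 0).
  apply: measurable_fun_ifT => //; first exact: measurable_fun_eqr.
  exact: measurable_fun_sgr.
apply: (Rintegral_odd_symmetric Gsym mD Dsym mh).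
  apply: (@le_bounded_integrable _ _ _ Gam D _ 1) => // s _.
  by case: ifP => _; rewrite ?normr0// -[Num.sg _]expr1 norm_sg_le1.
by move=> s; rewrite fodd godd oppr_eq0 sgrN; case: ifP => _; rewrite ?oppr0.
Qed.

End SymmetricMeasure.

(** * The symmetric covariation as a limit of fractional derivatives *)

Lemma Gamma_frac_pow_coef {R : realType} (alpha beta : R) : 0 < alpha -> 0 <= beta ->
  (forall k : nat, alpha - beta + 1 != - k%:R) ->
  Gamma (alpha - beta + 1) / Gamma (alpha + 1) * frac_pow_coef beta alpha = 1.
Proof.
move=> alpha0 beta0 no_pole; have alpha1 : 0 < alpha + 1 by lra.
have -> : Gamma (alpha + 1) = Euler_integral (alpha + 1) by rewrite /Gamma alpha1.
rewrite /frac_pow_coef; set n := (Num.truncn beta).+1; set P := \prod_(_ < _) _.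
have n0 : 0 < alpha - beta + 1 + n%:R.
  by have /andP[_] := truncn_itv beta0; rewrite -/n; lra.
have := Gamma_rising no_pole n0; rewrite -/P => GP.
have E1 := lt0r_neq0 (Euler_integral_gt0 alpha1).
have E2 := lt0r_neq0 (Euler_integral_gt0 n0).
transitivity (Gamma (alpha - beta + 1) * P / Euler_integral (alpha - beta + 1 + n%:R)).
  have cancel_e (g e e2V r : R) : e != 0 -> g / e * (e * e2V * r) = g * r * e2V.
    by move=> eN0; field.
  exact (cancel_e _ _ _ _ E1).
by rewrite GP divff.
Qed.

Lemma frac_theta1E {R : realType} (alpha beta : R) m theta :
  frac_theta1 alpha beta m theta =
  fun s => frac_line_pow alpha beta m theta.1 theta.2 s.1 s.2.
Proof. by []. Qed.

Lemma frac_theta2E {R : realType} (alpha beta : R) m theta :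
  frac_theta2 alpha beta m theta =
  fun s => frac_line_pow alpha beta m theta.2 theta.1 s.2 s.1.
Proof.
apply/funext => s; rewrite /frac_theta2.
have -> : (fun t => `|dotp (theta.1, t) s| `^ alpha) =
    (fun t => `|t * s.2 + theta.1 * s.1| `^ alpha).
  by apply/funext => t; rewrite /dotp/= addrC.
by [].
Qed.

Unset Implicit Arguments.
Set Strict Implicit.

Theorem theorem3p7 (R : realType) (d : measure_display)
    (T : measurableType d) (P : probability T R)
    (X : {RV P >-> (R * R)%type}) (alpha : R)
    (Gam : {finite_measure set (R * R)%type -> \bar R})
    (alpha_gt0 : 0 < alpha) (alpha_le2 : alpha <= 2)
    (X_SaS : is_SaS X alpha Gam)
    (beta : R) (beta_ge0 : 0 <= beta)
    (m : nat) (m_le1 : (m <= 1)%N)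
    (no_pole : forall k : nat, alpha - beta + 1 != - k%:R) :
  let I1 (theta : R * R) :=
    \int[Gam]_(s in circle_le) frac_theta1 alpha beta m theta s in
  let I2 (theta : R * R) :=
    \int[Gam]_(s in circle_gt) frac_theta2 alpha beta m theta s in
  [/\ (\forall theta \near (0 : R, 1 : R)^', Gam.-integrable circle_le
         (EFin \o frac_theta1 alpha beta m theta)),
      (\forall theta \near (1 : R, 0 : R)^', Gam.-integrable circle_gt
         (EFin \o frac_theta2 alpha beta m theta)),
      cvg (I1 theta @[theta --> (0 : R, 1 : R)^']),
      cvg (I2 theta @[theta --> (1 : R, 0 : R)^'])
    & symmetric_covariation Gam alpha beta m =
        Gamma (alpha - beta + 1) / Gamma (alpha + 1) *
        (lim (I1 theta @[theta --> (0 : R, 1 : R)^']) +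
         lim (I2 theta @[theta --> (1 : R, 0 : R)^']))].
Proof.
move=> I1 I2; have [Gsym _] := X_SaS.
pose C := frac_pow_coef beta alpha.
pose L1 := \int[Gam]_(s in circle_le) half_kernel alpha beta m s.1 s.2.
pose L2 := \int[Gam]_(s in circle_gt) half_kernel alpha beta m s.2 s.1.
have near1 e : 0 < e -> \forall theta \near (0 : R, 1 : R)^',
    Gam.-integrable circle_le (EFin \o frac_theta1 alpha beta m theta) /\
    `|C * L1 - I1 theta| < e.
  move=> e0.
  have [del del0 Hdel] := integral_frac_line_pow_near measurable_circle_le
    measurable_fst measurable_snd (fun s (Ds : circle_le s) => Ds.1)
    (fun s (Ds : circle_le s) => Ds.2) alpha_gt0 beta_ge0 m_le1
    (Rintegral_sg_balanced Gsym measurable_circle_le circle_leN measurable_fst measurable_snd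
      (fun=> erefl) (fun=> erefl)) e0.
  apply: nbhs_dnbhs; apply/nbhs_ballP; exists del => // theta [/= p1 q1].
  rewrite /I1 frac_theta1E; apply: (Hdel theta.1 theta.2).
    by move: p1; rewrite /ball/= sub0r normrN.
  by move: q1; rewrite /ball/= distrC.
have near2 e : 0 < e -> \forall theta \near (1 : R, 0 : R)^',
    Gam.-integrable circle_gt (EFin \o frac_theta2 alpha beta m theta) /\
    `|C * L2 - I2 theta| < e.
  move=> e0.
  have uv1 (s : R * R) : circle_gt s -> s.2 ^+ 2 + s.1 ^+ 2 = 1 by case=> s1 _; rewrite addrC.
  have [del del0 Hdel] := integral_frac_line_pow_near measurable_circle_gt
    measurable_snd measurable_fst uv1
    (fun s (Ds : circle_gt s) => ltW Ds.2) alpha_gt0 beta_ge0 m_le1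
    (Rintegral_sg_balanced Gsym measurable_circle_gt circle_gtN measurable_snd measurable_fst
      (fun=> erefl) (fun=> erefl)) e0.
  apply: nbhs_dnbhs; apply/nbhs_ballP; exists del => // theta [/= q1 p1].
  rewrite /I2 frac_theta2E; apply: (Hdel theta.2 theta.1).
    by move: p1; rewrite /ball/= sub0r normrN.
  by move: q1; rewrite /ball/= distrC.
have cvg1 : I1 theta @[theta --> (0 : R, 1 : R)^'] --> C * L1.
  by apply/cvgrPdist_lt => e /near1; apply: filterS => theta [].
have cvg2 : I2 theta @[theta --> (1 : R, 0 : R)^'] --> C * L2.
  by apply/cvgrPdist_lt => e /near2; apply: filterS => theta [].
have P1 := dnbhs_pair_proper (0 : R) 1; have P2 := dnbhs_pair_proper (1 : R) 0.
split.
- by apply: filterS (near1 1 ltr01) => theta [].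
- by apply: filterS (near2 1 ltr01) => theta [].
- by apply/cvg_ex; exists (C * L1).
- by apply/cvg_ex; exists (C * L2).
- rewrite (cvg_lim _ cvg1)// (cvg_lim _ cvg2)// symmetric_covariation_split//.
  rewrite -mulrDr mulrA Gamma_frac_pow_coef ?mul1r//.
Qed.
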